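(* Let $\Lambda$ be a finite dimensional algebra over a field, let $0\to A\to B\to C\to0$ be a short exact sequence in $\mathrm{mod}\,\Lambda$, let $k>1$ be an integer and $n$ a nonnegative integer. If $k\text{-}\operatorname{edell}A\le n-1$ and $(k-1)\text{-}\operatorname{dell}B\le n$, then $(k-1)\text{-}\operatorname{edell}C\le n$.
   Context: $\mathrm{mod}\,\Lambda$ is the category of finitely generated right $\Lambda$-modules. $\mathbb N$ is the set of nonnegative integers; the infimum of the empty set is $+\infty$. $\Omega M$ is the kernel of a projective cover of $M$, $\Omega^0M=M$, $\Omega^{n+1}M=\Omega(\Omega^nM)$. ''$U$ is a direct summand of $V$ up to projective summands'' means that $U$ is isomorphic to a direct summand of $V\oplus P$ for some projective $P$. For an integer $k\ge1$: $k\text{-}\operatorname{dell}M$ is the infimum of all $n\in\mathbb N$ such that $\Omega^nM$ is a direct summand of $\Omega^{n+k}N$ up to projective summands for some $N\in\mathrm{mod}\,\Lambda$; and $k\text{-}\operatorname{edell}M$ is the infimum of all $n\in\mathbb N$ such that for every integer $k'\ge1$ and every right $\Lambda$-module $X$ of injective dimension $\mathrm{id}\,X=n+k-1+k'$ one has $\mathrm{Ext}_\Lambda^{n+k'}(M,X)=0$. *)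

(* Defs.v *)
From HB Require Import structures.
From mathcomp Require Import all_boot all_order all_algebra all_field.
From mathcomp Require Import boolp constructive_ereal.

Set Implicit Arguments.
Unset Strict Implicit.
Unset Printing Implicit Defensive.

Import Order.TTheory GRing.Theory Num.Theory.
Local Open Scope ring_scope.

(* The infimum of the empty set is +oo. *)
Definition inf_nat (S : nat -> Prop) : \bar int :=
  match pselect (exists n, `[< S n >]) with
  | left exS => ((ex_minn exS)%:Z)%:E
  | right _ => +oo%E
  end.

(* Modules over R are mathcomp's left modules; a right module over a ring L is
   a left module over the converse ring L^c. *)

Definition fin_gen (R : pzRingType) (M : lmodType R) : Prop :=
  exists (n : nat) (e : 'I_n -> M),
    forall x : M, exists c : 'I_n -> R, x = \sum_(i < n) c i *: e i.

Definition surj (U V : Type) (f : U -> V) : Prop :=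
  forall y, exists x, f x = y.

Definition exact_at (R : pzRingType) (U V W : lmodType R)
    (f : {linear U -> V}) (g : {linear V -> W}) : Prop :=
  forall y : V, g y = 0 <-> exists x : U, f x = y.

Definition short_exact (R : pzRingType) (A B C : lmodType R)
    (f : {linear A -> B}) (g : {linear B -> C}) : Prop :=
  [/\ injective f, exact_at f g & surj g].

Definition lmod_iso (R : pzRingType) (U V : lmodType R) : Prop :=
  exists f : {linear U -> V}, bijective f.

Definition projective (R : pzRingType) (P : lmodType R) : Prop :=
  forall (U V : lmodType R) (p : {linear U -> V}) (f : {linear P -> V}),
    surj p -> exists g : {linear P -> U}, forall x, p (g x) = f x.

Definition injective_mod (R : pzRingType) (I : lmodType R) : Prop :=
  forall (U V : lmodType R) (i : {linear U -> V}) (f : {linear U -> I}),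
    injective i -> exists g : {linear V -> I}, forall x, g (i x) = f x.

(* S is superfluous in P: S + T = P implies T = P for every submodule T. *)
Definition superfluous (R : pzRingType) (P : lmodType R) (S : P -> Prop) :
    Prop :=
  forall T : {pred P}, submod_closed T ->
    (forall x, exists y z, [/\ S y, z \in T & x = y + z]) ->
    forall x, x \in T.

Definition projective_cover (R : pzRingType) (P M : lmodType R)
    (p : {linear P -> M}) : Prop :=
  [/\ projective P, surj p & superfluous (fun x => p x = 0)].

(* W is (isomorphic to) Omega M.  Projective covers are unique only up to
   isomorphism, so syzygies are described by a relation. *)
Definition is_Omega (R : pzRingType) (M W : lmodType R) : Prop :=
  exists (P : lmodType R) (p : {linear P -> M}) (i : {linear W -> P}),
    [/\ projective_cover p, injective i & exact_at i p].

Fixpoint is_Omegan (R : pzRingType) (n : nat) (M W : lmodType R) : Prop :=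
  match n with
  | 0 => lmod_iso M W
  | m.+1 => exists V : lmodType R, is_Omegan m M V /\ is_Omega V W
  end.

Definition direct_summand (R : pzRingType) (U V : lmodType R) : Prop :=
  exists W : lmodType R, lmod_iso (U * W)%type V.

Definition stable_summand (R : pzRingType) (U V : lmodType R) : Prop :=
  exists P : lmodType R, projective P /\ direct_summand U (V * P)%type.

Record proj_resolution (R : pzRingType) (M : lmodType R) := ProjResolution {
  pres : nat -> lmodType R;
  pdiff : forall i, {linear pres i.+1 -> pres i};
  paug : {linear pres 0 -> M};
  pres_proj : forall i, projective (pres i);
  paug_surj : surj paug;
  paug_exact : exact_at (pdiff 0) paug;
  pdiff_exact : forall i, exact_at (pdiff i.+1) (pdiff i)
}.

Record inj_resolution (R : pzRingType) (X : lmodType R) := InjResolution {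
  ires : nat -> lmodType R;
  idiff : forall i, {linear ires i -> ires i.+1};
  iaug : {linear X -> ires 0};
  ires_inj : forall i, injective_mod (ires i);
  iaug_inj : injective iaug;
  iaug_exact : exact_at iaug (idiff 0);
  idiff_exact : forall i, exact_at (idiff i) (idiff i.+1)
}.

(* The zero module gets injective dimension 0. *)
Definition injdim (R : pzRingType) (X : lmodType R) : \bar int :=
  inf_nat (fun m => exists r : inj_resolution X,
    forall i, (m < i)%N -> forall x : ires r i, x = 0).

Definition cocycle (R : pzRingType) (M X : lmodType R)
    (r : proj_resolution M) (n : nat) (f : {linear pres r n -> X}) : Prop :=
  forall x, f (pdiff r n x) = 0.

Definition coboundary (R : pzRingType) (M X : lmodType R)
    (r : proj_resolution M) (n : nat) : {linear pres r n -> X} -> Prop :=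
  match n with
  | 0 => fun f => forall x, f x = 0
  | m.+1 => fun f => exists g : {linear pres r m -> X},
                       forall x, f x = g (pdiff r m x)
  end.

(* Ext^n(M, X) = 0, Ext^n(M, X) being the n-th cohomology group of Hom(P, X)
   for a projective resolution P of M.  It does not depend on P. *)
Definition Ext_eq0 (R : pzRingType) (n : nat) (M X : lmodType R) : Prop :=
  forall (r : proj_resolution M) (f : {linear pres r n -> X}),
    cocycle f -> coboundary f.

Definition dell (R : pzRingType) (k : nat) (M : lmodType R) : \bar int :=
  inf_nat (fun n => exists N U V : lmodType R,
    [/\ fin_gen N, is_Omegan n M U, is_Omegan (n + k) N V
      & stable_summand U V]).

(* X is not required to be finitely generated. *)
Definition edell (R : pzRingType) (k : nat) (M : lmodType R) : \bar int :=
  inf_nat (fun n => forall (k' : nat) (X : lmodType R), (1 <= k')%N ->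
    injdim X = ((n + k - 1 + k')%N%:Z)%:E -> Ext_eq0 (n + k') M X).

(* Main.v *)
(* Write Ext as cohomology of Hom(-, I) for an injective resolution I of X with
   id X = n + k - 2 + k'.  The hypothesis on A gives Ext^(n-1+k')(A, X) = 0.  Up
   to dimension shifting, Ext^(n+k')(B, X) is a direct summand of
   Ext^(n+k-1+k')(N, X), which vanishes because n + k - 1 + k' > id X.  The long
   exact sequence of Ext(-, X) then yields Ext^(n+k')(C, X) = 0. *)

Require Import Defs.
From HB Require Import structures.
From mathcomp Require Import all_boot all_order all_algebra all_field.
From mathcomp Require Import boolp constructive_ereal.
From mathcomp Require Import finmap zify.
From mathcomp Require Import -(notations) monalg.

Set Implicit Arguments.
Unset Strict Implicit.
Unset Printing Implicit Defensive.

Import Order.TTheory GRing.Theory Num.Theory.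
Local Open Scope ring_scope.

Section LinearMaps.
Variable R : pzRingType.
Implicit Types U V W I P Q X Y : lmodType R.

Lemma linear_ofP U V (f : U -> V) :
  linear f -> exists g : {linear U -> V}, g =1 f.
Proof.
move=> fL; pose F := GRing.isLinear.Build R U V _ f fL.
by exists (HB.pack_for {linear U -> V} f F).
Qed.

Lemma inj_lift X V U (i : {linear X -> V}) (f : {linear U -> V}) :
  injective i -> (forall u, exists x, i x = f u) ->
  exists g : {linear U -> X}, forall u, i (g u) = f u.
Proof.
move=> i_inj /choice[g gE].
have [|h hE] := @linear_ofP U X g; last by exists h => u; rewrite hE gE.
by move=> a u v; apply: i_inj; rewrite linearP !gE linearP.
Qed.

Lemma surj_factor V Q Y (q : {linear V -> Q}) (f : {linear V -> Y}) :
  surj q -> (forall x, q x = 0 -> f x = 0) ->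
  exists g : {linear Q -> Y}, forall x, g (q x) = f x.
Proof.
move=> /choice[s qs] kill.
have sE x y : q x = q y -> f x = f y.
  move=> qxy; apply/eqP; rewrite -subr_eq0 -linearB; apply/eqP/kill.
  by rewrite linearB qxy subrr.
have [|h hE] := @linear_ofP Q Y (f \o s).
  by move=> a u v /=; rewrite -linearP; apply: sE; rewrite linearP !qs.
by exists h => x; rewrite hE; apply: sE; rewrite qs.
Qed.

Lemma exact_comp0 U V W (f : {linear U -> V}) (g : {linear V -> W}) :
  exact_at f g -> forall x, g (f x) = 0.
Proof. by move=> ex x; apply/ex; exists x. Qed.

End LinearMaps.

Section Kernel.
Variables (R : pzRingType) (U V : lmodType R) (f : {linear U -> V}).

Definition ker_pred : {pred U} := fun x => f x == 0.

Fact ker_submod_closed : submod_closed ker_pred.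
Proof.
split; first by rewrite unfold_in linear0.
by move=> a x y; rewrite !unfold_in linearP => /eqP-> /eqP->;
  rewrite scaler0 addr0.
Qed.

HB.instance Definition _ :=
  GRing.isSubmodClosed.Build R U ker_pred ker_submod_closed.

Record kernel := Kernel { ker_val : U; _ : ker_val \in ker_pred }.

HB.instance Definition _ := [isSub for ker_val].
HB.instance Definition _ := [Choice of kernel by <:].
HB.instance Definition _ := [SubChoice_isSubLmodule of kernel by <:].

Definition ker_incl : {linear kernel -> U} := val.

Lemma ker_incl_inj : injective ker_incl.
Proof. exact: val_inj. Qed.

Lemma ker_incl_exact : exact_at ker_incl f.
Proof.
move=> y; split=> [fy0|[[x xK] <-]]; last exact/eqP.
by have yK : y \in ker_pred by [apply/eqP]; exists (Kernel yK).
Qed.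

End Kernel.

Section ProjectiveInjective.
Variable R : pzRingType.
Implicit Types U V W Z I P : lmodType R.

Lemma projective_lift_exact P U V W (a : {linear U -> V}) (b : {linear V -> W})
    (h : {linear P -> V}) :
  projective P -> exact_at a b -> (forall x, b (h x) = 0) ->
  exists l : {linear P -> U}, forall x, a (l x) = h x.
Proof.
move=> projP ex bh0; have kE := ker_incl_exact b.
have [u|a' a'E] := inj_lift (f := a) (@ker_incl_inj _ _ _ b).
  exact/kE/(exact_comp0 ex).
have [u|h' h'E] := inj_lift (f := h) (@ker_incl_inj _ _ _ b).
  exact/kE.
have [|l lE] := projP _ _ a' h'.
  move=> y; have [x xE] := (ex _).1 (exact_comp0 kE y).
  by exists x; apply: (@ker_incl_inj _ _ _ b); rewrite a'E.
by exists l => x; rewrite -a'E lE h'E.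
Qed.

Lemma injective_extend_exact I U V W Z (a : {linear U -> V})
    (b : {linear V -> W}) (c : {linear W -> Z}) (h : {linear V -> I}) :
  injective_mod I -> exact_at a b -> exact_at b c ->
  (forall x, h (a x) = 0) ->
  exists l : {linear W -> I}, forall x, l (b x) = h x.
Proof.
move=> injI exab exbc ha0; have kE := ker_incl_exact c.
have [x|b' b'E] := inj_lift (f := b) (@ker_incl_inj _ _ _ c).
  exact/kE/(exact_comp0 exbc).
have [|x b'x0|h' h'E] := surj_factor (q := b') (f := h).
- move=> y; have [x xE] := (exbc _).1 (exact_comp0 kE y).
  by exists x; apply: (@ker_incl_inj _ _ _ c); rewrite b'E.
- have [u <- //] : exists u, a u = x.
  by apply/exab; rewrite -b'E b'x0 linear0.
have [l lE] := injI _ _ _ h' (@ker_incl_inj _ _ _ c).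
by exists l => x; rewrite -b'E lE h'E.
Qed.

End ProjectiveInjective.

(* [hom_exact r n M] is the vanishing of H^(n+1)(Hom(M, I)) for the given
   injective resolution I of X, hence of Ext^(n+1)(M, X); mind the shift. *)
Definition hom_exact (R : pzRingType) (X : lmodType R) (r : inj_resolution X)
    (n : nat) (M : lmodType R) : Prop :=
  forall h : {linear M -> ires r n.+1}, (forall x, idiff r n.+1 (h x) = 0) ->
  exists l : {linear M -> ires r n}, forall x, idiff r n (l x) = h x.

Section HomExact.
Variables (R : pzRingType) (X : lmodType R) (r : inj_resolution X).
Implicit Types A B C M N U V W P : lmodType R.

Lemma hom_exact_projective n P : projective P -> hom_exact r n P.
Proof.
move=> projP h dh0.
by apply: projective_lift_exact dh0 => //; apply: idiff_exact.
Qed.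

Lemma hom_exact_zero n M :
  (forall x : ires r n.+1, x = 0) -> hom_exact r n M.
Proof. by move=> I0 h _; exists \0 => x; rewrite [LHS]I0 [RHS]I0. Qed.

Lemma hom_exact_quot A B C (f : {linear A -> B}) (g : {linear B -> C}) n :
  short_exact f g -> hom_exact r n A -> hom_exact r n.+1 B ->
  hom_exact r n.+1 C.
Proof.
move=> [f_inj ex g_surj] HA HB h dh0.
have [x|l lE] := HB (h \o g); first exact: dh0.
have [x|m mE] := HA (l \o f).
  by rewrite /= lE /= (exact_comp0 ex) linear0.
have [m' m'E] := ires_inj m f_inj.
have [//|x gx0|l' l'E] := surj_factor (q := g) (f := l \- (idiff r n \o m')).
  by have [y <-] := (ex x).1 gx0; rewrite /= m'E mE subrr.
exists l' => y; have [x <-] := g_surj y.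
by rewrite l'E linearB /= (exact_comp0 (@idiff_exact _ _ r n)) subr0 lE.
Qed.

Lemma hom_exact_sub A B C (f : {linear A -> B}) (g : {linear B -> C}) n :
  short_exact f g -> hom_exact r n.+1 C -> hom_exact r n B ->
  hom_exact r n A.
Proof.
move=> [f_inj ex g_surj] HC HB h dh0.
have [h' h'E] := ires_inj h f_inj.
have [//|x gx0|q qE] := surj_factor (q := g) (f := idiff r n.+1 \o h').
  by have [y <-] := (ex x).1 gx0; rewrite /= h'E dh0.
have [y|s sE] := HC q.
  have [x <-] := g_surj y.
  by rewrite qE /= (exact_comp0 (@idiff_exact _ _ r _)).
have [x|t tE] := HB (h' \- (s \o g)).
  by rewrite linearB /= sE qE subrr.
by exists (t \o f) => x; rewrite /= tE /= (exact_comp0 ex) linear0 subr0 h'E.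
Qed.

Lemma hom_exact_retract U V (i : {linear U -> V}) (p : {linear V -> U}) n :
  cancel i p -> hom_exact r n V -> hom_exact r n U.
Proof.
move=> ipK HV h dh0; have [x|l lE] := HV (h \o p); first exact: dh0.
by exists (l \o i) => x; rewrite /= lE /= ipK.
Qed.

Lemma hom_exact_prod U V n :
  hom_exact r n U -> hom_exact r n V -> hom_exact r n (U * V)%type.
Proof.
move=> HU HV h dh0.
have [|i1 i1E] := @linear_ofP R U (U * V)%type (fun u => (u, 0)).
  by move=> a x y; congr pair; rewrite /= scaler0 addr0.
have [|i2 i2E] := @linear_ofP R V (U * V)%type (fun v => (0, v)).
  by move=> a x y; congr pair; rewrite /= scaler0 addr0.
have [x|l1 l1E] := HU (h \o i1); first exact: dh0.
have [x|l2 l2E] := HV (h \o i2); first exact: dh0.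
exists ((l1 \o fst) \+ (l2 \o snd)) => -[u v].
rewrite linearD /= l1E l2E /= i1E i2E -linearD; congr (h _).
by congr pair; rewrite /= ?addr0 ?add0r.
Qed.

Lemma hom_exact_iso U V n : lmod_iso U V -> hom_exact r n U <-> hom_exact r n V.
Proof.
move=> [f [g fK gK]].
have [|g' g'E] := @linear_ofP R V U g.
  by move=> a x y; rewrite -{1}[x]gK -{1}[y]gK -linearP fK.
split; [apply: (hom_exact_retract (i := g') (p := f))
       |apply: (hom_exact_retract (i := f) (p := g'))].
  by move=> x; rewrite g'E gK.
by move=> x; rewrite g'E fK.
Qed.

Lemma hom_exact_stable_summand U V n :
  stable_summand U V -> hom_exact r n V -> hom_exact r n U.
Proof.
move=> [P [projP [W UW_iso]]] HV.
have /(hom_exact_iso n UW_iso) HUW : hom_exact r n (V * P)%type.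
  exact/hom_exact_prod/hom_exact_projective.
have [|i iE] := @linear_ofP R U (U * W)%type (fun u => (u, 0)).
  by move=> a x y; congr pair; rewrite /= scaler0 addr0.
by apply: (hom_exact_retract (i := i) (p := fst)) HUW => x; rewrite iE.
Qed.

Lemma hom_exact_syzygy W P M (i : {linear W -> P}) (p : {linear P -> M}) n :
  projective P -> short_exact i p ->
  hom_exact r n W <-> hom_exact r n.+1 M.
Proof.
move=> projP sex; split=> [HW|HM].
  exact/(hom_exact_quot sex HW)/hom_exact_projective.
exact/(hom_exact_sub sex HM)/hom_exact_projective.
Qed.

Lemma hom_exact_Omegan m n M W :
  is_Omegan m M W -> hom_exact r n W <-> hom_exact r (m + n) M.
Proof.
elim: m n W => [|m IH] n W /=; first by move=> /(hom_exact_iso n)->.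
move=> [V [/IH VE [P [p [i [[projP p_surj _] i_inj ex]]]]]].
rewrite addSnnS; apply: iff_trans (VE _).
by apply: hom_exact_syzygy (And3 i_inj ex p_surj).
Qed.

End HomExact.

Lemma Ext_hom_exact1 (R : pzRingType) (X M : lmodType R)
    (r : inj_resolution X) (pr : proj_resolution M) :
  (forall f : {linear pres pr 1 -> X}, cocycle f -> coboundary f) <->
  hom_exact r 0 M.
Proof.
have aug0 := exact_comp0 (@paug_exact _ _ pr).
have d0 := exact_comp0 (@pdiff_exact _ _ pr 0).
split=> [HP h dh0|HI f f0].
  have [x|l lE] := projective_lift_exact (h := h \o paug pr)
    (@pres_proj _ _ pr 0) (@idiff_exact _ _ r 0); first exact: dh0.
  have [x|f fE] := inj_lift (f := l \o pdiff pr 0) (@iaug_inj _ _ r).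
    by apply/iaug_exact; rewrite /= lE /= aug0 linear0.
  have [x|g gE] := HP f.
    by apply: (@iaug_inj _ _ r); rewrite fE /= d0 !linear0.
  have [||l' l'E] := surj_factor (q := paug pr) (f := l \- (iaug r \o g)).
  - exact: paug_surj.
  - move=> x /paug_exact[y <-] /=.
    by rewrite -gE fE subrr.
  exists l' => y; have [x <-] := paug_surj pr y.
  by rewrite l'E linearB /= (exact_comp0 (@iaug_exact _ _ r)) subr0 lE.
have [x|e eE] := injective_extend_exact (h := iaug r \o f) (@ires_inj _ _ r 0)
  (@pdiff_exact _ _ pr 0) (@paug_exact _ _ pr).
  by rewrite /= f0 linear0.
have [||q qE] := surj_factor (q := paug pr) (f := idiff r 0 \o e).
- exact: paug_surj.
- move=> x /paug_exact[y <-] /=; rewrite eE.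
  exact: (exact_comp0 (@iaug_exact _ _ r)).
have [y|s sE] := HI q.
  have [x <-] := paug_surj pr y.
  by rewrite qE /= (exact_comp0 (@idiff_exact _ _ r _)).
have [x|g gE] := inj_lift (f := e \- (s \o paug pr)) (@iaug_inj _ _ r).
  by apply/iaug_exact; rewrite linearB /= sE qE subrr.
exists g => x; apply: (@iaug_inj _ _ r).
by rewrite gE /= aug0 linear0 subr0 eE.
Qed.

Lemma Ext_hom_exact (R : pzRingType) (X M : lmodType R)
    (r : inj_resolution X) (pr : proj_resolution M) n :
  (forall f : {linear pres pr n.+1 -> X}, cocycle f -> coboundary f) <->
  hom_exact r n M.
Proof.
elim: n M pr => [|n IH] M pr; first exact: Ext_hom_exact1.
have [x|a aE] := inj_lift (f := pdiff pr 0) (@ker_incl_inj _ _ _ (paug pr)).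
  exact/ker_incl_exact/(exact_comp0 (@paug_exact _ _ pr)).
have a_surj : surj a.
  move=> y; have [x xE] : exists x, pdiff pr 0 x = ker_incl _ y.
    exact/paug_exact/(exact_comp0 (ker_incl_exact _)).
  by exists x; apply: (@ker_incl_inj _ _ _ (paug pr)); rewrite aE.
have a_exact : exact_at (pdiff pr 1) a.
  move=> x; split=> [ax0|/pdiff_exact dx0].
    by apply/pdiff_exact; rewrite -aE ax0 linear0.
  by apply: (@ker_incl_inj _ _ _ (paug pr)); rewrite aE dx0 linear0.
pose pr' := ProjResolution (fun i => @pres_proj _ _ pr i.+1) a_surj a_exact
  (fun i => @pdiff_exact _ _ pr i.+1).
apply: iff_trans (IH _ pr') _.
apply: (hom_exact_syzygy _ _ (@pres_proj _ _ pr 0)).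
split; [exact: ker_incl_inj | exact: ker_incl_exact | exact: paug_surj].
Qed.

Section FreeCover.
Variables (R : nzRingType) (M : lmodType R).

Definition free_lift_fun (V : lmodType R) (u : M -> V) (x : malg M R) : V :=
  \sum_(k <- msupp x) mcoeff k x *: u k.

Lemma free_lift_funEw (V : lmodType R) (u : M -> V) (x : malg M R)
    (D : {fset M}) :
  (msupp x `<=` D)%fset -> free_lift_fun u x = \sum_(k <- D) mcoeff k x *: u k.
Proof.
move=> sxD; apply: big_fset_incl => // k _ kx.
by rewrite mcoeff_outdom // scale0r.
Qed.

Fact free_lift_is_linear (V : lmodType R) (u : M -> V) :
  linear (free_lift_fun u).
Proof.
move=> a x y; pose D := (msupp x `|` msupp y)%fset.
rewrite !(@free_lift_funEw _ _ _ D) ?fsubsetUl ?fsubsetUr //.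
  rewrite scaler_sumr -big_split /=; apply: eq_bigr => k _.
  by rewrite mcoeffD mcoeffZ scalerDl scalerA.
exact: fsubset_trans (msuppD_le _ _) (fsetSU _ (msuppZ_le _ _)).
Qed.

HB.instance Definition _ (V : lmodType R) (u : M -> V) :=
  GRing.isLinear.Build R (malg M R) V _
    (@free_lift_fun V u) (@free_lift_is_linear V u).

Lemma free_liftU (V : lmodType R) (u : M -> V) k :
  free_lift_fun u (mkmalgU k 1) = u k.
Proof.
by rewrite (free_lift_funEw _ msuppU_le) big_seq_fset1 mcoeffUU scale1r.
Qed.

Lemma free_lift_unique (V : lmodType R) (f : {linear (malg M R) -> V}) :
  f =1 free_lift_fun (fun k => f (mkmalgU k 1)).
Proof.
move=> x; rewrite {1}[x]monalgE linear_sum; apply: eq_bigr => k _.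
rewrite -linearZ; congr (f _); apply/malgP => j.
by rewrite mcoeffZ !mcoeffU mulrnAr mulr1.
Qed.

Lemma free_projective : projective (malg M R).
Proof.
move=> U V p f p_surj.
have /choice[u uE] k : exists x, p x = f (mkmalgU k 1) by apply: p_surj.
exists (free_lift_fun u) => x; rewrite [RHS]free_lift_unique [LHS]linear_sum.
by apply: eq_bigr => k _; rewrite linearZ uE.
Qed.

Definition free_cover : {linear (malg M R) -> M} := free_lift_fun id.

Lemma free_cover_surj : surj free_cover.
Proof. by move=> y; exists (mkmalgU y 1); apply: free_liftU. Qed.

End FreeCover.

Section FreeResolution.
Variables (R : nzRingType) (M : lmodType R).

Fixpoint free_syzygy (n : nat) : lmodType R :=
  if n is m.+1 then kernel (free_cover (free_syzygy m)) else M.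

Definition free_diff n :
    {linear malg (free_syzygy n.+1) R -> malg (free_syzygy n) R} :=
  ker_incl (free_cover (free_syzygy n)) \o free_cover (free_syzygy n.+1).

Lemma exact_free_diff n : exact_at (free_diff n) (free_cover (free_syzygy n)).
Proof.
move=> y; split=> [/ker_incl_exact[x <-]|[x <-]].
  by have [z <-] := free_cover_surj x; exists z.
exact: (exact_comp0 (@ker_incl_exact _ _ _ _)).
Qed.

Lemma free_diff_exact n : exact_at (free_diff n.+1) (free_diff n).
Proof.
move=> y; rewrite -exact_free_diff.
have dE : free_diff n y = ker_incl _ (free_cover _ y) by [].
split=> [dy0|y0]; last by rewrite dE y0 linear0.
by apply: ker_incl_inj; rewrite -dE dy0 linear0.
Qed.

Definition free_resolution : proj_resolution M :=
  ProjResolution (fun n => @free_projective R (free_syzygy n))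
    (@free_cover_surj R M) (@exact_free_diff 0) free_diff_exact.

End FreeResolution.

Lemma inf_natP (S : nat -> Prop) (n : nat) :
  (inf_nat S <= (n%:Z)%:E)%E -> exists2 m, (m <= n)%N & S m.
Proof.
rewrite /inf_nat; case: pselect => // exS.
by case: ex_minnP => m /asboolP Sm _; rewrite lee_fin lez_nat; exists m.
Qed.

Lemma inf_nat_le (S : nat -> Prop) (n : nat) :
  S n -> (inf_nat S <= (n%:Z)%:E)%E.
Proof.
move=> /asboolP Sn; rewrite /inf_nat.
case: pselect => [exS|[]]; last by exists n.
by case: ex_minnP => m _ m_min; rewrite lee_fin lez_nat m_min.
Qed.

Lemma inf_nat_eq (S : nat -> Prop) (n : nat) : inf_nat S = (n%:Z)%:E -> S n.
Proof.
rewrite /inf_nat; case: pselect => // exS.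
by case: ex_minnP => m /asboolP Sm _ [] <-.
Qed.

(* n - 1 is taken in int, so it is -1 for n = 0. *)
Theorem lemma2p29 (K : fieldType) (L : falgType K) (A B C : lmodType L^c)
    (f : {linear A -> B}) (g : {linear B -> C}) (k n : nat) :
  fin_gen A -> fin_gen B -> fin_gen C ->
  short_exact f g ->
  (1 < k)%N ->
  (edell k A <= (n%:Z - 1)%:E)%E ->
  (dell (k - 1) B <= (n%:Z)%:E)%E ->
  (edell (k - 1) C <= (n%:Z)%:E)%E.
Proof.
move=> _ _ _ sex k_gt1; case: n => [|n].
  by rewrite sub0r /edell /inf_nat; case: pselect.
have -> : n.+1%:Z - 1 = n%:Z by rewrite intS addrAC subrr add0r.
move=> /inf_natP[a a_le edA] /inf_natP[b b_le].
move=> [N [U [V [_ UB VN UV]]]]; apply: inf_nat_le => -[//|k'] X _ idX.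
have [r r0] := inf_nat_eq idX.
have EA : hom_exact r (n + k') A.
  apply/(Ext_hom_exact r (free_resolution A))=> h.
  have {edA} := edA (n - a + k').+1 X isT.
  have -> : (a + k - 1 + (n - a + k').+1 = n.+1 + (k - 1) - 1 + k'.+1)%N by lia.
  have -> : (a + (n - a + k').+1 = (n + k').+1)%N by lia.
  by move=> /(_ idX); apply.
have EB : hom_exact r (n + k').+1 B.
  have -> : ((n + k').+1 = b + ((n + k').+1 - b))%N by lia.
  apply/(hom_exact_Omegan _ _ UB)/(hom_exact_stable_summand UV).
  apply/(hom_exact_Omegan _ _ VN)/hom_exact_zero => x; apply: r0; lia.
rewrite -addSnnS => pr; apply/(Ext_hom_exact r pr).
exact: hom_exact_quot sex EA EB.
Qed.
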